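(* Let $Q$ be a finite quiver with vertex set $I$, $\Theta\in(\mathbf{Q}I)^*$ a stability condition with slope function $\mu$, and $d,n\in\mathbf{N}I$ nonzero dimension vectors. The smooth model $M_{d,n}^\Theta(Q)$ parametrizes equivalence classes of pairs $(M,f)$ consisting of a $\mu$-semistable complex representation $M$ of $Q$ of dimension vector $d$ and a nonzero tuple of linear maps $f=(f_i:V_i\to M_i)_{i\in I}$ such that $\mu(U)<\mu(M)$ for every nonzero proper subrepresentation $U$ of $M$ containing the image of $f$; here $(M,f)$ and $(M',f')$ are equivalent if and only if there exists an isomorphism of representations $\varphi:M\to M'$ such that $f'=\varphi f$ (i.e. $f_i'=\varphi_i f_i$ for all $i\in I$). That is, the ($\mathbf{C}$-)points of $M_{d,n}^\Theta(Q)$ are in natural bijection with these equivalence classes.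
   Context: Representations are finite-dimensional over $\mathbf{C}$. For $0\neq d\in\mathbf{N}I$ put $\dim d=\sum_i d_i$ and $\mu(d)=\Theta(d)/\dim d$; the slope of a nonzero representation is the slope of its dimension vector. A nonzero representation $X$ is $\mu$-semistable (resp. $\mu$-stable) if $\mu(U)\le\mu(X)$ (resp. $<$) for all nonzero proper subrepresentations $U\subset X$. $V_i$ denotes a fixed vector space of dimension $n_i$. Moduli spaces: for a quiver $Q$, dimension vector $d$ and stability $\Theta$, let $R_d(Q)=\bigoplus_{\alpha:i\to j}\mathrm{Hom}(M_i,M_j)$ with $\dim M_i=d_i$, acted on by $G_d=\prod_i \mathrm{GL}(M_i)$ by base change. $M_d^{\rm st}(Q)$ denotes the geometric quotient by $G_d$ of the open subset of stable representations in $R_d(Q)$ (King's moduli space of stable representations). Smooth model: define $\hat Q$ by adding to $Q$ a vertex $\infty$ and $n_i$ arrows $\infty\to i$ for each $i\in I$; put $\hat d_i=d_i$ ($i\in I$), $\hat d_\infty=1$; $\hat\Theta_i=\Theta_i$ ($i\in I$), $\hat\Theta_\infty=\mu(d)+\varepsilon$ with $\varepsilon\in\mathbf{Q}$ positive and sufficiently small. Representations of $\hat Q$ of dimension vector $\hat d$ with $M_\infty=\mathbf{C}$ are identified with pairs $(M,f)$, $f_i:V_i\to M_i$. The smooth model is $M_{d,n}^\Theta(Q):=M_{\hat d}^{\rm st}(\hat Q)$, the moduli space of $\hat\Theta$-stable representations of $\hat Q$ of dimension vector $\hat d$. *)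

(* Defs.v *)
From HB Require Import structures.
From mathcomp Require Import all_boot all_order all_algebra.
From mathcomp Require Import complex.
From mathcomp Require Import all_classical all_reals topology.

Set Implicit Arguments.
Unset Strict Implicit.
Unset Printing Implicit Defensive.

Import Order.TTheory GRing.Theory Num.Theory.
Local Open Scope classical_set_scope.
Local Open Scope ring_scope.

Record quiver := Quiver {
  vertex : finType;
  arrow : finType;
  src : arrow -> vertex;
  tgt : arrow -> vertex }.

(* A dimension vector is a function [vertex Q -> nat]; a stability condition,
   i.e. a linear form on QI, is given by its values Theta_i on the standard
   basis. *)
Section Slope.
Context {Q : quiver}.
Implicit Types (Theta : vertex Q -> rat) (e : vertex Q -> nat).

Definition total_dim e : nat := (\sum_i e i)%N.

Definition slope Theta e : rat :=
  (\sum_i Theta i * (e i)%:R) / (total_dim e)%:R.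

End Slope.

Record rep (k : fieldType) (Q : quiver) := Rep {
  space :> vertex Q -> vectType k;
  amap : forall a : arrow Q, 'Hom(space (src a), space (tgt a)) }.

Section Representations.
Context {k : fieldType} {Q : quiver}.
Implicit Types (M : rep k Q) (Theta : vertex Q -> rat).

Definition dimvec M : vertex Q -> nat := fun i => \dim {:M i}.

Definition is_subrep M (U : forall i, {vspace M i}) : Prop :=
  forall a, (amap M a @: U (src a) <= U (tgt a))%VS.

Definition subdim M (U : forall i, {vspace M i}) : vertex Q -> nat :=
  fun i => \dim (U i).

Definition nonzero_sub M (U : forall i, {vspace M i}) : Prop :=
  exists i, U i != 0%VS.

Definition proper_sub M (U : forall i, {vspace M i}) : Prop :=
  exists i, U i != fullv.

Definition nonzero_rep M : Prop := exists i, dimvec M i != 0%N.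

Definition semistable Theta M : Prop :=
  nonzero_rep M /\
  forall U : forall i, {vspace M i},
    is_subrep U -> nonzero_sub U -> proper_sub U ->
    slope Theta (subdim U) <= slope Theta (dimvec M).

Definition stable Theta M : Prop :=
  nonzero_rep M /\
  forall U : forall i, {vspace M i},
    is_subrep U -> nonzero_sub U -> proper_sub U ->
    slope Theta (subdim U) < slope Theta (dimvec M).

Definition rep_iso (M N : rep k Q) (phi : forall i, 'Hom(M i, N i)) : Prop :=
  (forall i, bijective (phi i)) /\
  forall a, (phi (tgt a) \o amap M a = amap N a \o phi (src a))%VF.

End Representations.

(* The affine space R_d(Q), with M_i = k^(d i) as column vectors. *)
Definition rep_space (k : fieldType) (Q : quiver) (d : vertex Q -> nat) : Type :=
  forall a : arrow Q, 'M[k]_(d (tgt a), d (src a)).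

Section RepSpace.
Context {k : fieldType} {Q : quiver} {d : vertex Q -> nat}.
Implicit Types X : rep_space k d.

Definition rep_of X : rep k Q :=
  @Rep k Q (fun i => 'cV[k]_(d i)) (fun a => linfun (mulmx (X a))).

(* X and X' lie in the same orbit of G_d = \prod_i GL_(d i). *)
Definition same_orbit X X' : Prop :=
  exists g : forall i, 'M[k]_(d i),
    (forall i, g i \in unitmx) /\
    forall a, X' a = g (tgt a) *m X a *m invmx (g (src a)).

(* The coordinate ring of R_d(Q), as an algebra of functions. *)
Inductive polyfun : (rep_space k d -> k) -> Prop :=
| polyfun_const (c : k) : polyfun (fun=> c)
| polyfun_coord (a : arrow Q) i j : polyfun (fun X => X a i j)
| polyfun_add p q : polyfun p -> polyfun q -> polyfun (fun X => p X + q X)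
| polyfun_mul p q : polyfun p -> polyfun q -> polyfun (fun X => p X * q X).

End RepSpace.

(* Spaces with functions (classical, i.e. closed points only): [regular V f]
   says that f is regular on the open set V; the values of f outside V are
   irrelevant. *)
Record fspace (k : fieldType) := FSpace {
  fcarrier :> topologicalType;
  regular : set fcarrier -> (fcarrier -> k) -> Prop }.

(* Geometric quotient by a group acting on X with orbit relation [orb]; the
   functions phi \o pi are exactly the invariant functions. *)
Record geometric_quotient (k : fieldType) (X : fspace k)
    (orb : X -> X -> Prop) (Y : fspace k) (pi : X -> Y) : Prop := {
  gq_surj : forall y, exists x, pi x = y;
  gq_fibre : forall x x', pi x = pi x' <-> orb x x';
  gq_open : forall V : set Y, open V <-> open (pi @^-1` V);
  gq_regular : forall (V : set Y) (phi : Y -> k), open V ->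
    (regular V phi <-> regular (pi @^-1` V) (phi \o pi)) }.

(* Zariski topology and regular functions on a subset S of R_d(Q). *)
Definition locus (k : fieldType) (Q : quiver) (d : vertex Q -> nat)
  (S : rep_space k d -> Prop) : Type := {X : rep_space k d | S X}.

Section Locus.
Context {k : fieldType} {Q : quiver} {d : vertex Q -> nat}.
Variable S : rep_space k d -> Prop.

HB.instance Definition _ := gen_eqMixin (locus S).
HB.instance Definition _ := gen_choiceMixin (locus S).

Definition zariski_open : set (set (locus S)) := [set W |
  forall x, W x -> exists p, [/\ polyfun p, p (sval x) != 0 &
    forall y : locus S, p (sval y) != 0 -> W y]].

Lemma zariski_openT : zariski_open setT.
Proof.
by move=> x _; exists (fun=> 1); split=> //; [exact: polyfun_const|exact: oner_neq0].
Qed.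

Lemma zariski_openI : setI_closed zariski_open.
Proof.
move=> A B oA oB x [/oA[p [pp px pA]] /oB[q [pq qx qB]]].
exists (fun X => p X * q X); split; first exact: polyfun_mul.
  by rewrite mulf_neq0.
by move=> y; rewrite mulf_eq0 negb_or => /andP[/pA Ay /qB By].
Qed.

Lemma zariski_open_bigU (I : Type) (f : I -> set (locus S)) :
  (forall i, zariski_open (f i)) -> zariski_open (\bigcup_i f i).
Proof.
move=> of_ x [i _ /of_[p [pp px pf]]]; exists p; split=> // y /pf fy.
by exists i.
Qed.

HB.instance Definition _ := isOpenTopological.Build (locus S)
  zariski_openT zariski_openI zariski_open_bigU.

Definition zariski_regular (W : set (locus S)) (f : locus S -> k) : Prop :=
  forall x, W x -> exists p q, [/\ polyfun p, polyfun q, q (sval x) != 0 &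
    forall y, W y -> q (sval y) != 0 -> f y = p (sval y) / q (sval y)].

Definition locus_fspace : fspace k :=
  @FSpace k (locus S : topologicalType) zariski_regular.

Definition locus_orbit (x y : locus_fspace) : Prop :=
  same_orbit (sval x) (sval y).

End Locus.

Definition stable_locus (k : fieldType) (Q : quiver) (Theta : vertex Q -> rat)
    (d : vertex Q -> nat) : fspace k :=
  locus_fspace (fun X : rep_space k d => stable Theta (rep_of X)).

(* (Y, pi) is the moduli space M_d^st(Q) of stable representations, together
   with its quotient map. *)
Definition is_stable_moduli (k : fieldType) (Q : quiver)
    (Theta : vertex Q -> rat) (d : vertex Q -> nat)
    (Y : fspace k) (pi : stable_locus k Theta d -> Y) : Prop :=
  geometric_quotient (@locus_orbit k Q d _) pi.

(* The orbit space, with the quotient topology and the invariant regular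
   functions, realizes the geometric quotient. *)
Section Existence.
Context {k : fieldType} {Q : quiver} {d : vertex Q -> nat}.
Variable S : rep_space k d -> Prop.
Local Notation L := (locus_fspace S).

Definition orbit_space : Type :=
  {O : set L | exists x, O = [set y | locus_orbit x y]}.

HB.instance Definition _ := gen_eqMixin orbit_space.
HB.instance Definition _ := gen_choiceMixin orbit_space.

Definition orbit_pi (x : L) : orbit_space :=
  exist _ [set y | locus_orbit x y] (ex_intro _ x erefl).

Definition orbit_open : set (set orbit_space) :=
  [set V | open (orbit_pi @^-1` V)].

Lemma orbit_openT : orbit_open setT.
Proof. by rewrite /orbit_open /= preimage_setT; exact: openT. Qed.

Lemma orbit_openI : setI_closed orbit_open.
Proof. by move=> ? ? ? ?; exact: openI. Qed.

Lemma orbit_open_bigU (I : Type) (f : I -> set orbit_space) :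
  (forall i, orbit_open (f i)) -> orbit_open (\bigcup_i f i).
Proof. by move=> h; apply: bigcup_open => i _; exact: h. Qed.

HB.instance Definition _ := isOpenTopological.Build orbit_space
  orbit_openT orbit_openI orbit_open_bigU.

Definition orbit_fspace : fspace k :=
  @FSpace k (orbit_space : topologicalType)
    (fun V phi => zariski_regular (orbit_pi @^-1` V) (phi \o orbit_pi)).

Lemma orbit_geometric_quotient :
  geometric_quotient (@locus_orbit k Q d S) (orbit_pi : L -> orbit_fspace).
Proof.
have orb_refl (x : L) : locus_orbit x x.
  exists (fun=> 1%:M); split=> [i|a]; first exact: unitmx1.
  by rewrite mul1mx invmx1 mulmx1.
have orb_sym (x y : L) : locus_orbit x y -> locus_orbit y x.
  case=> g [gu gE]; exists (fun i => invmx (g i)); split=> [i|a].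
    by rewrite unitmx_inv.
  by rewrite gE invmxK !mulmxA mulVmx// mul1mx mulmxKV.
have orb_trans (x y z : L) : locus_orbit x y -> locus_orbit y z -> locus_orbit x z.
  case=> g [gu gE] [h [hu hE]]; exists (fun i => h i *m g i); split=> [i|a].
    by rewrite unitmx_mul hu gu.
  have ug := gu (src a); have uh := hu (src a).
  have uhg : h (src a) *m g (src a) \in unitmx by rewrite unitmx_mul uh ug.
  apply: (can_inj (mulmxK uhg)); rewrite mulmxKV// hE gE -!mulmxA.
  by rewrite (mulKmx uh) mulVmx// mulmx1.
split=> //.
- by case=> O [x E]; exists x; exact: eq_exist.
- move=> x x'; split=> [/(congr1 sval)/= E|xx'].
    by have : [set y | locus_orbit x' y] x' := orb_refl x'; rewrite -E.
  apply: eq_exist; apply/seteqP; split=> y /= h; last exact: orb_trans h.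
  exact: orb_trans (orb_sym _ _ xx') h.
Qed.

End Existence.

Section Smooth_model.
Context {Q : quiver}.
Implicit Types (Theta : vertex Q -> rat) (d n : vertex Q -> nat).

(* Vertex oo is [None]; the n i arrows oo -> i are the [inr (Tagged _ k)] with
   k : 'I_(n i). *)
Definition hatQ n : quiver :=
  @Quiver (option (vertex Q)) (arrow Q + {i : vertex Q & 'I_(n i)})%type
    (fun b => if b is inl a then Some (src a) else None)
    (fun b => match b with inl a => Some (tgt a) | inr t => Some (tag t) end).

Definition hatd n d : vertex (hatQ n) -> nat :=
  fun v => if v is Some i then d i else 1%N.

Definition hatTheta n Theta d (eps : rat) : vertex (hatQ n) -> rat :=
  fun v => if v is Some i then Theta i else slope Theta d + eps.

Definition smooth_model_locus (k : fieldType) Theta d n (eps : rat) : fspace k :=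
  stable_locus k (@hatTheta n Theta d eps) (@hatd n d).

(* (Y, pi) is M_(d,n)^Theta(Q) = M_(hat d)^st(hat Q) with its quotient map. *)
Definition is_smooth_model (k : fieldType) Theta d n (eps : rat)
    (Y : fspace k) (pi : smooth_model_locus k Theta d n eps -> Y) : Prop :=
  is_stable_moduli pi.

End Smooth_model.

Arguments is_smooth_model {Q} k Theta d n eps Y pi.

(* Pairs (M, f), with V_i = k^(n i). *)
Record framed (k : fieldType) (Q : quiver) (n : vertex Q -> nat) := Framed {
  frep :> rep k Q;
  fmap : forall i, 'Hom('cV[k]_(n i), frep i) }.

Section Framed.
Context {k : fieldType} {Q : quiver} {n : vertex Q -> nat}.
Implicit Types (p : framed k n) (Theta : vertex Q -> rat) (d : vertex Q -> nat).

Definition framed_equiv p p' : Prop :=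
  exists phi : forall i, 'Hom(p i, p' i),
    rep_iso phi /\ forall i, fmap p' i = (phi i \o fmap p i)%VF.

Definition admissible Theta d p : Prop :=
  [/\ dimvec p =1 d,
      semistable Theta p,
      (exists i, fmap p i != 0) &
      forall U : forall i, {vspace p i},
        is_subrep U -> nonzero_sub U -> proper_sub U ->
        (forall i, (limg (fmap p i) <= U i)%VS) ->
        slope Theta (subdim U) < slope Theta (dimvec p)].

(* Classes are bare predicates: the universe of [vectType k] is too large for
   [set (framed k n)]. *)
Definition framed_class Theta d p : framed k n -> Prop :=
  fun p' => admissible Theta d p' /\ framed_equiv p p'.

Definition framed_classes Theta d : Type :=
  {C : framed k n -> Prop |
    exists p, admissible Theta d p /\ C = framed_class Theta d p}.

(* A point of R_(hat d)(hat Q) as a pair (M, f), with M_oo = k: f_i maps the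
   j-th basis vector of V_i to the image of 1 under the j-th arrow oo -> i. *)
Definition framed_of d (X : rep_space k (@hatd Q n d)) : framed k n :=
  @Framed k Q n (rep_of (fun a : arrow Q => X (inl a) : 'M_(d (tgt a), d (src a))))
    (fun i => linfun (mulmx (\matrix_(l < d i, j < n i)
       (X (inr (Tagged (fun i => 'I_(n i)) j)) : 'M_(d i, 1)) l ord0))).

End Framed.

Arguments framed_classes k {Q} n Theta d.

(* Main.v *)
(* A subrepresentation of the hat Q-representation attached to (M, f) is a
   subrepresentation U of M together with 0 or C at the vertex oo, the latter
   only if U contains the image of f.  For mu = mu(d) and D = dim d, the
   representation has slope mu + eps / (D + 1).  With 0 at oo, the slope
   inequality reads mu(U) < mu + eps / (D + 1), i.e. mu(U) <= mu for small eps;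
   with C at oo it reads
   Theta(U) - mu dim U < - eps (D - dim U) / (D + 1), i.e. Theta(U) < mu dim U
   for small eps, which also excludes U = 0, i.e. f = 0.  So stable points are
   exactly the admissible pairs.  An element (g_i, c) of the group acts on pairs
   as c^-1 g_i, so that orbits are equivalence classes. *)

Require Import Defs.
From mathcomp Require Import all_boot all_order all_algebra.
From mathcomp Require Import complex.
From mathcomp Require Import all_classical all_reals topology.
From mathcomp Require Import lra.

Set Implicit Arguments.
Unset Strict Implicit.
Unset Printing Implicit Defensive.
Import Order.TTheory GRing.Theory Num.Theory VectorInternalTheory.
Local Open Scope ring_scope.

(** * Choice of epsilon and slopes on the extended quiver *)

Lemma nonzero_gap (T : finType) (F : T -> rat) :
  exists2 eps : rat, 0 < eps & forall t, F t != 0 -> eps <= `|F t|.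
Proof.
(* The default value 1 keeps the minimum positive when [F] vanishes identically. *)
exists (\big[Order.min/1]_(t | F t != 0) `|F t|).
  by apply: lt_bigmin => // t Ft; rewrite normr_gt0.
by move=> t Ft; exact: bigmin_le_cond.
Qed.

(** The linear form without denominator: it still gives the right comparison at [e = 0], where
    [slope] is 0 by the convention on division by zero. *)
Definition theta (I : finType) (Theta : I -> rat) (e : I -> nat) : rat :=
  \sum_i Theta i * (e i)%:R.

Lemma theta_slope (Q : quiver) (Theta : vertex Q -> rat) e :
  (0 < total_dim e)%N -> theta Theta e = slope Theta e * (total_dim e)%:R.
Proof. by move=> u0; rewrite /slope divfK // pnatr_eq0 -lt0n. Qed.

Lemma total_dim_gt0 (Q : quiver) (e : vertex Q -> nat) :
  (exists i, e i != 0%N) -> (0 < total_dim e)%N.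
Proof. by case=> i ei; rewrite /total_dim (bigD1 i) //= addn_gt0 lt0n ei. Qed.

(** The bound ranges over all subvectors [e] of [d], not only those of actual subrepresentations, so
    one threshold serves every representation. *)
Definition small_eps (Q : quiver) (Theta : vertex Q -> rat) (d : vertex Q -> nat)
    (eps : rat) : Prop :=
  0 < eps /\ forall e : vertex Q -> nat, (forall i, (e i <= d i)%N) ->
    let x := theta Theta e - slope Theta d * (total_dim e)%:R in
    x != 0 -> eps < `|x|.

Lemma small_epsP (Q : quiver) (Theta : vertex Q -> rat) (d : vertex Q -> nat) :
  exists2 eps0 : rat, 0 < eps0 &
    forall eps, 0 < eps -> eps < eps0 -> small_eps Theta d eps.
Proof.
(* Every entry of a subvector of [d] is at most [total_dim d], so subvectors live in one finite
   type, as [nonzero_gap] requires. *)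
pose F (e : {ffun vertex Q -> 'I_(total_dim d).+1}) : rat :=
  theta Theta (fun i => e i) - slope Theta d * (total_dim (fun i => e i))%:R.
have [eps0 eps0_gt0 gap] := nonzero_gap F; exists eps0 => // eps eps_gt0 lt_eps.
split=> // e led /= x_neq0; apply: lt_le_trans lt_eps _.
have ltd i : (e i < (total_dim d).+1)%N.
  rewrite ltnS (leq_trans (led i)) // /total_dim (bigD1 i) //=.
  exact: leq_addr.
have := gap [ffun i => Ordinal (ltd i)].
rewrite /F; suff -> : (fun i => [ffun i => Ordinal (ltd i)] i : nat) = e by apply.
by apply: funext => i; rewrite ffunE.
Qed.

Lemma big_option (T : Type) (idx : T) (op : Monoid.com_law idx) (I : finType)
    (F : option I -> T) :
  \big[op/idx]_v F v = op (F None) (\big[op/idx]_i F (Some i)).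
Proof.
rewrite (bigD1 None) //=; congr (op _ _).
by rewrite (reindex_omap Some id) => [|[]] //=; apply: eq_bigl => i; rewrite eqxx.
Qed.

Lemma slope_hat (Q : quiver) (Theta : vertex Q -> rat) (d n : vertex Q -> nat)
    (eps : rat) (e : vertex (hatQ n) -> nat) :
  let e' i := e (Some i) in
  slope (hatTheta Theta d eps) e =
  (theta Theta e' + (slope Theta d + eps) * (e None)%:R) /
  ((total_dim e')%:R + (e None)%:R).
Proof.
rewrite /= /slope /total_dim !big_option /=; congr (_ / _).
  by rewrite addrC.
by rewrite natrD addrC.
Qed.

Lemma total_dim_le (Q : quiver) (e e' : vertex Q -> nat) :
  (forall i, (e i <= e' i)%N) -> (total_dim e <= total_dim e')%N.
Proof. by move=> le; apply: leq_sum. Qed.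

Lemma total_dim_lt (Q : quiver) (e e' : vertex Q -> nat) i :
  (forall i, (e i <= e' i)%N) -> (e i < e' i)%N ->
  (total_dim e < total_dim e')%N.
Proof.
move=> le lti; rewrite /total_dim (bigD1 i) //= [ltnRHS](bigD1 i) //=.
by rewrite -addSn leq_add // leq_sum.
Qed.

(** Clearing denominators gives [(t - mu * u) * (D + 1) < eps * u]. This holds when [t <= mu * u];
    otherwise the gap makes the left side exceed [eps * (D + 1)], hence [eps * u]. *)
Lemma hat_slope_lt0 (u D t mu eps : rat) : 0 < u -> u <= D -> 0 < eps ->
  (t - mu * u != 0 -> eps < `|t - mu * u|) ->
  (t / u < (mu * D + (mu + eps)) / (D + 1)) = (t / u <= mu).
Proof.
move=> u_gt0 leuD eps_gt0 gap.
have D_gt0 : 0 < D + 1 by lra.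
rewrite ltr_pdivrMr // mulrAC ltr_pdivlMr // ler_pdivrMr //.
case: (lerP t (mu * u)) => [le_t | lt_t]; first by nra.
move: gap; rewrite gt_eqF ?subr_gt0 // gtr0_norm ?subr_gt0 // => /(_ isT) gap.
by apply/negbTE; rewrite -leNgt; nra.
Qed.

(** Clearing denominators gives [(t - mu * u) * (D + 1) < - eps * (D - u)], whose right side is
    negative. When [t < mu * u], the gap pushes the left side below [- eps * (D + 1)], which
    suffices since [u >= 0]. *)
Lemma hat_slope_lt1 (u D t mu eps : rat) : 0 <= u -> u < D -> 0 < eps ->
  (t - mu * u != 0 -> eps < `|t - mu * u|) ->
  ((t + (mu + eps)) / (u + 1) < (mu * D + (mu + eps)) / (D + 1)) = (t < mu * u).
Proof.
move=> u_ge0 ltuD eps_gt0 gap.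
have D_gt0 : 0 < D + 1 by lra.
have u1_gt0 : 0 < u + 1 by lra.
rewrite ltr_pdivrMr // mulrAC ltr_pdivlMr //.
case: (ltrP t (mu * u)) => [lt_t | le_t]; last first.
  by apply/negbTE; rewrite -leNgt; nra.
move: gap; rewrite lt_eqF ?subr_lt0 // ltr0_norm ?subr_lt0 // => /(_ isT) gap.
by nra.
Qed.

Lemma hat_slope_sub (Q : quiver) (Theta : vertex Q -> rat) (d n : vertex Q -> nat)
    (eps : rat) (e : vertex (hatQ n) -> nat) :
  (exists i, d i != 0%N) -> small_eps Theta d eps ->
  (forall i, (e (Some i) <= d i)%N) -> (exists i, e (Some i) != 0%N) ->
  e None = 0%N ->
  (slope (hatTheta Theta d eps) e <
     slope (hatTheta Theta d eps) (@hatd Q n d)) =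
  (slope Theta (fun i => e (Some i)) <= slope Theta d).
Proof.
move=> /total_dim_gt0 d_gt0 [eps_gt0 gap] led /total_dim_gt0 e_gt0 e0.
rewrite !slope_hat e0 mulr0 !addr0 mulr1 (theta_slope _ d_gt0).
by rewrite hat_slope_lt0 ?ltr0n ?ler_nat ?total_dim_le //; exact: gap.
Qed.

(** The criterion uses [theta] instead of [slope] because [e'] may be zero; it then reads [0 < 0],
    which is how stability rules out [f = 0]. *)
Lemma hat_slope_framed (Q : quiver) (Theta : vertex Q -> rat) (d n : vertex Q -> nat)
    (eps : rat) (e : vertex (hatQ n) -> nat) :
  (exists i, d i != 0%N) -> small_eps Theta d eps ->
  (forall i, (e (Some i) <= d i)%N) -> (exists i, e (Some i) != d i) ->
  e None = 1%N ->
  let e' i := e (Some i) in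
  (slope (hatTheta Theta d eps) e <
     slope (hatTheta Theta d eps) (@hatd Q n d)) =
  (theta Theta e' < slope Theta d * (total_dim e')%:R).
Proof.
move=> /total_dim_gt0 d_gt0 [eps_gt0 gap] led [i ned] e1 /=.
rewrite !slope_hat e1 !mulr1 (theta_slope _ d_gt0).
rewrite hat_slope_lt1 ?ler0n ?ltr_nat //; last exact: gap.
by apply: (total_dim_lt (i := i)) => //; rewrite ltn_neqAle ned led.
Qed.

(** * Linear maps and matrices *)

Lemma linfun_mulmxE (k : fieldType) m n (A : 'M[k]_(m, n)) (v : 'cV[k]_n) :
  linfun (mulmx A) v = A *m v.
Proof. by rewrite lfunE. Qed.

Lemma linfun_mulmx_inj (k : fieldType) m n :
  injective (fun A : 'M[k]_(m, n) => linfun (mulmx A : 'cV[k]_n -> 'cV_m)).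
Proof.
move=> A B /lfunP eqAB; apply/matrixP => i j.
have := eqAB (delta_mx j 0); rewrite !linfun_mulmxE -!colE.
by move/matrixP/(_ i 0); rewrite !mxE.
Qed.

Definition mx_of (k : fieldType) m n (f : 'Hom('cV[k]_n, 'cV[k]_m)) : 'M[k]_(m, n) :=
  \matrix_(i, j) f (delta_mx j 0) i 0.

Lemma mul_mx_of (k : fieldType) m n (f : 'Hom('cV[k]_n, 'cV[k]_m)) v :
  mx_of f *m v = f v.
Proof.
rewrite [in RHS](matrix_sum_delta v) linear_sum.
apply/matrixP => i j; rewrite !ord1 mxE summxE; apply: eq_bigr => l _.
by rewrite big_ord1 linearZ !mxE mulrC.
Qed.

Lemma mx_ofK (k : fieldType) m n (f : 'Hom('cV[k]_n, 'cV[k]_m)) :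
  linfun (mulmx (mx_of f)) = f.
Proof. by apply/lfunP => v; rewrite linfun_mulmxE mul_mx_of. Qed.

(** In general [f^-1] is only a pseudo-inverse; a trivial kernel makes it a left inverse, and
    bijectivity makes it two-sided. *)
Lemma bij_lfunK (k : fieldType) (V W : vectType k) (f : 'Hom(V, W)) :
  bijective f -> cancel f f^-1%VF /\ cancel f^-1%VF f.
Proof.
move=> bij_f; have fK : cancel f f^-1%VF.
  exact/lker0_lfunK/lker0P/bij_inj.
by split=> //; apply/(bij_can_sym bij_f).
Qed.

Lemma mx_of_unit (k : fieldType) n (f : 'End('cV[k]_n)) :
  bijective f -> mx_of f \in unitmx.
Proof.
move=> /bij_lfunK[_ fVK]; have : mx_of f *m mx_of f^-1%VF = 1%:M.
  apply: linfun_mulmx_inj; apply/lfunP => v.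
  by rewrite !linfun_mulmxE -mulmxA !mul_mx_of fVK mul1mx.
by case/mulmx1_unit.
Qed.

(** The image is spanned by the columns. This converts between the image of [f] and the individual
    arrows out of infinity. *)
Lemma limg_mulmx_sub (k : fieldType) m n (A : 'M[k]_(m, n)) (U : {vspace 'cV[k]_m}) :
  (limg (linfun (mulmx A)) <= U)%VS <-> forall j, col j A \in U.
Proof.
split=> [/subvP sAU j | AU].
  by apply: sAU; rewrite colE -linfun_mulmxE memv_img ?memvf.
apply/subvP => _ /memv_imgP[v _ ->]; rewrite linfun_mulmxE.
suff -> : A *m v = \sum_j v j 0 *: col j A by apply: memv_suml => j _; exact: memvZ.
apply/matrixP => i j; rewrite !ord1 mxE summxE; apply: eq_bigr => l _.
by rewrite !mxE mulrC.
Qed.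


(** * Equivalence of framed representations *)

Lemma framed_equiv_refl (k : fieldType) (Q : quiver) (n : vertex Q -> nat)
    (p : framed k n) : framed_equiv p p.
Proof.
exists (fun i => \1%VF); split=> [|i]; last by rewrite comp_lfun1l.
split=> [i|a]; last by rewrite comp_lfun1l comp_lfun1r.
by exists id => x; rewrite id_lfunE.
Qed.

Lemma framed_equiv_sym (k : fieldType) (Q : quiver) (n : vertex Q -> nat)
    (p p' : framed k n) : framed_equiv p p' -> framed_equiv p' p.
Proof.
case=> phi [[bij_phi phiM] phif].
have phiK i := (bij_lfunK (bij_phi i)).1.
have phiVK i := (bij_lfunK (bij_phi i)).2.
exists (fun i => (phi i)^-1%VF); split=> [|i]; last first.
  by apply/lfunP => x; rewrite phif !comp_lfunE /= phiK.
split=> [i|a]; first by exists (phi i).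
apply/lfunP => x; rewrite !comp_lfunE /= -{1}[x]phiVK.
by have /lfunP/(_ ((phi (src a))^-1%VF x)) := phiM a; rewrite !comp_lfunE => <-; exact: phiK.
Qed.

Lemma framed_equiv_trans (k : fieldType) (Q : quiver) (n : vertex Q -> nat)
    (p p' p'' : framed k n) :
  framed_equiv p p' -> framed_equiv p' p'' -> framed_equiv p p''.
Proof.
case=> phi [[bij_phi phiM] phif] [psi [[bij_psi psiM] psif]].
exists (fun i => psi i \o phi i)%VF; split=> [|i]; last first.
  by rewrite psif phif comp_lfunA.
split=> [i|a]; last by rewrite -comp_lfunA phiM !comp_lfunA psiM.
have [g gK Kg] := bij_comp (bij_psi i) (bij_phi i).
by exists g => x; rewrite comp_lfunE; [exact: gK | exact: Kg].
Qed.

Lemma dim_limg_bij (k : fieldType) (V W : vectType k) (f : 'Hom(V, W)) U :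
  bijective f -> \dim (f @: U) = \dim U.
Proof.
by move/bij_inj/lker0P/eqP => f0; apply: limg_dim_eq; rewrite f0 capv0.
Qed.

Lemma limg_bij (k : fieldType) (V W : vectType k) (f : 'Hom(V, W)) :
  bijective f -> limg f = fullv.
Proof.
move=> /bij_lfunK[_ fVK]; apply/eqP; rewrite eqEsubv subvf /=; apply/subvP => w _.
by rewrite -[w]fVK memv_img ?memvf.
Qed.

Lemma neq_fullv (k : fieldType) (V : vectType k) (U : {vspace V}) :
  (U != fullv) = (\dim U != \dim {:V}).
Proof. by rewrite (dimv_leqif_eq (subvf U)). Qed.

Lemma limg_eq0 (k : fieldType) (V W : vectType k) (f : 'Hom(V, W)) :
  (limg f == 0%VS) = (f == 0).
Proof.
apply/eqP/eqP => [f0 | ->]; last first.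
  by apply/eqP; rewrite -subv0; apply/subvP => _ /memv_imgP[x _ ->]; rewrite lfunE mem0v.
apply/lfunP => x; apply/eqP; rewrite [X in _ == X]lfunE /= -memv0 -f0.
exact: memv_img (memvf x).
Qed.

(** Subrepresentations of [p'] are carried to [p] by the inverse isomorphism, which preserves their
    dimension vectors and hence all slopes. *)
Lemma admissible_equiv (k : fieldType) (Q : quiver) (n : vertex Q -> nat)
    (Theta : vertex Q -> rat) (d : vertex Q -> nat) (p p' : framed k n) :
  framed_equiv p p' -> admissible Theta d p -> admissible Theta d p'.
Proof.
move=> pp' [dimp [nz ss] [i0 fi0] lt_f].
have [phi [[bij_phi phiM] phif]] := framed_equiv_sym pp'.
have dimpp' : dimvec p' = dimvec p.
  by apply: funext => i; rewrite /dimvec -(limg_bij (bij_phi i)) dim_limg_bij.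
have img (U : forall i, {vspace p' i}) :
    let V i := (phi i @: U i)%VS in
    [/\ subdim V = subdim U, is_subrep U -> is_subrep V,
      nonzero_sub U -> nonzero_sub V & Defs.proper_sub U -> Defs.proper_sub V].
  have dimV i : \dim (phi i @: U i) = \dim (U i) by exact: dim_limg_bij.
  split=> [|sU a|[i Ui]|[i Ui]].
  - exact: funext.
  - by rewrite -limg_comp -phiM limg_comp limgS.
  - by exists i; rewrite -dimv_eq0 dimV dimv_eq0.
  - exists i; rewrite neq_fullv dimV.
    by have := congr1 (fun f => f i) dimpp'; rewrite /dimvec => <-; rewrite -neq_fullv.
split; [by rewrite dimpp'| split; first by rewrite /nonzero_rep dimpp' | |].
- move=> U sU nU pU; have [/= <- sV nV pV] := img U.
  by rewrite dimpp'; apply: ss; auto.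
- exists i0; apply: contra_neq fi0 => f0; apply/lfunP => x.
  by rewrite phif f0 comp_lfun0r.
move=> U sU nU pU fU; have [/= <- sV nV pV] := img U.
rewrite dimpp'; apply: lt_f; auto => i.
by rewrite phif limg_comp limgS.
Qed.

Lemma framed_class_eq (k : fieldType) (Q : quiver) (n : vertex Q -> nat)
    (Theta : vertex Q -> rat) (d : vertex Q -> nat) (p p' : framed k n) :
  framed_equiv p p' -> framed_class Theta d p = framed_class Theta d p'.
Proof.
move=> pp'; apply: funext => q; apply: propext.
split=> -[aq pq]; split=> //; apply: framed_equiv_trans pq => //.
exact: framed_equiv_sym.
Qed.

Lemma framed_class_inj (k : fieldType) (Q : quiver) (n : vertex Q -> nat)
    (Theta : vertex Q -> rat) (d : vertex Q -> nat) (p p' : framed k n) :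
  admissible Theta d p' -> framed_class Theta d p = framed_class Theta d p' ->
  framed_equiv p p'.
Proof.
move=> ap' eqpp'; have : framed_class Theta d p' p'.
  by split=> //; exact: framed_equiv_refl.
by rewrite -eqpp' => -[].
Qed.

(** * Group orbits and equivalence classes *)

Definition framing_mx (k : fieldType) (Q : quiver) (d n : vertex Q -> nat)
    (X : rep_space k (@hatd Q n d)) i : 'M[k]_(d i, n i) :=
  \matrix_(l, j) (X (inr (Tagged (fun i => 'I_(n i)) j)) : 'M_(d i, 1)) l ord0.

Lemma col_framing_mx (k : fieldType) (Q : quiver) (d n : vertex Q -> nat)
    (X : rep_space k (@hatd Q n d)) i (j : 'I_(n i)) :
  col j (framing_mx X i) = X (inr (Tagged (fun i => 'I_(n i)) j)).
Proof. by apply/matrixP => l m; rewrite !ord1 !mxE. Qed.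

Lemma framed_equiv_orbit (k : fieldType) (Q : quiver) (d n : vertex Q -> nat)
    (X X' : rep_space k (@hatd Q n d)) :
  framed_equiv (framed_of X) (framed_of X') <-> same_orbit X X'.
Proof.
split=> [[phi [[bij_phi phiM] phif]] | [g [g_unit gX]]].
  (* With the identity at infinity, the orbit relation at the arrows out of infinity is
     [f' = phi f], column by column. *)
  pose g (v : vertex (hatQ n)) : 'M[k]_(hatd d v) :=
    if v is Some i then mx_of (phi i) else 1%:M.
  have g_unit v : g v \in unitmx.
    by case: v => [i|]; [apply/mx_of_unit/bij_phi | exact: unitmx1].
  exists g; split=> // a; apply: (can_inj (mulmxK (g_unit _))).
  rewrite mulmxKV //.
  apply: linfun_mulmx_inj; apply/lfunP => x; rewrite !linfun_mulmxE -!mulmxA.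
  case: a x => [a|[i j]] x /=.
    rewrite !mul_mx_of; have /lfunP/(_ x) := phiM a.
    by rewrite !comp_lfunE /= !linfun_mulmxE.
  rewrite mul1mx mul_mx_of.
  have /lfunP/(_ (delta_mx j 0)) := phif i.
  rewrite !comp_lfunE /= -!/(framing_mx _ _) !linfun_mulmxE -!colE !col_framing_mx.
  move=> X'E; rewrite X'E; by rewrite -[RHS]mul_mx_of mulmxA mul_mx_of.
(* The component at infinity is a nonzero scalar. Dividing the other components by it cancels in the
   relations for arrows of [Q] and corrects the relation between the framings. *)
set c := g None 0 0.
have gNone : g None = c%:M.
  by apply/matrixP => i j; rewrite !ord1 !mxE eqxx.
have c_neq0 : c != 0.
  by have := g_unit None; rewrite unitmxE gNone det_scalar1 unitfE.
exists (fun i => linfun (mulmx (c^-1 *: (g (Some i) : 'M_(d i))))).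
split; [split=> [i|a] |move=> i].
- exists (mulmx (c *: invmx (g (Some i)))) => x;
    rewrite linfun_mulmxE -!scalemxAl -scalemxAr scalerA.
    rewrite mulfV // scale1r; exact: mulKmx (g_unit (Some i)) x.
  rewrite mulVf // scale1r; exact: mulKVmx (g_unit (Some i)) x.
- apply/lfunP => x; rewrite !comp_lfunE /= !linfun_mulmxE gX /= -!mulmxA.
  by rewrite -!scalemxAl -!scalemxAr (mulKmx (g_unit (Some (src a)))).
apply/lfunP => x; rewrite !comp_lfunE /= -!/(framing_mx _ _) !linfun_mulmxE mulmxA.
congr (_ *m x); apply/matrixP => l j.
have := col_framing_mx X' j; rewrite gX /= gNone => /matrixP/(_ l 0).
rewrite invmx_scalar mul_mx_scalar -scalemxAl [col j _ l 0]mxE => ->.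
rewrite [LHS]mxE [RHS]mxE; congr (_ * _).
by rewrite -col_framing_mx colE mulmxA -colE [LHS]mxE.
Qed.

(** * Stability on the extended quiver and admissibility *)

Lemma dimvec_rep_of (k : fieldType) (Q : quiver) (d : vertex Q -> nat)
    (X : rep_space k d) : dimvec (rep_of X) = d.
Proof. by apply: funext => i; rewrite /dimvec dimvf /dim /= muln1. Qed.

Lemma dimvec_framed_of (k : fieldType) (Q : quiver) (d n : vertex Q -> nat)
    (X : rep_space k (@hatd Q n d)) : dimvec (framed_of X) = d.
Proof. exact: dimvec_rep_of. Qed.

(** The arrows out of infinity start at the zero space and impose no condition. *)
Lemma subrep_hat0 (k : fieldType) (Q : quiver) (d n : vertex Q -> nat)
    (X : rep_space k (@hatd Q n d)) (U : forall v, {vspace rep_of X v}) :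
  U None = 0%VS ->
  is_subrep U <-> is_subrep (M := framed_of X) (fun i => U (Some i)).
Proof.
move=> U0; split=> sU; first by move=> a; exact: sU (inl a).
by case=> [a|[i j]] /=; [exact: sU | rewrite U0 limg0 sub0v].
Qed.

(** Each arrow out of infinity forces one column of the framing matrix into [U]; together they force
    in the image of [f]. *)
Lemma subrep_hatT (k : fieldType) (Q : quiver) (d n : vertex Q -> nat)
    (X : rep_space k (@hatd Q n d)) (U : forall v, {vspace rep_of X v}) :
  U None = fullv ->
  is_subrep U <-> is_subrep (M := framed_of X) (fun i => U (Some i)) /\
    forall i, (limg (Defs.fmap (framed_of X) i) <= U (Some i))%VS.
Proof.
move=> U0; split=> [sU | [sU fU]].
  split=> [a | i]; first exact: sU (inl a).
  apply/limg_mulmx_sub => j; rewrite col_framing_mx.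
  have := sU (inr (Tagged (fun i => 'I_(n i)) j)); rewrite /= U0.
  by move/limg_mulmx_sub/(_ 0); rewrite col_id.
case=> [a|[i j]] /=; first exact: sU.
rewrite U0; apply/limg_mulmx_sub => l; rewrite ord1 col_id.
by have /limg_mulmx_sub/(_ j) := fU i; rewrite col_framing_mx.
Qed.

Definition hat_sub (k : fieldType) (Q : quiver) (d n : vertex Q -> nat)
    (X : rep_space k (@hatd Q n d)) (U : forall i, {vspace framed_of X i})
    (W : {vspace 'cV[k]_1}) v : {vspace rep_of X v} :=
  if v is Some i then U i else W.

Lemma stable_framedP (k : fieldType) (Q : quiver) (Theta : vertex Q -> rat)
    (d n : vertex Q -> nat) (eps : rat) (X : rep_space k (@hatd Q n d)) :
  (exists i, d i != 0%N) -> small_eps Theta d eps ->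
  stable (hatTheta Theta d eps) (rep_of X) <-> admissible Theta d (framed_of X).
Proof.
move=> d_neq0 eps_small.
have d_gt0 := total_dim_gt0 d_neq0.
have dimF i : \dim {:framed_of X i} = d i.
  by have /(congr1 (fun e => e i)) := dimvec_framed_of X.
have dimU (U : forall i, {vspace framed_of X i}) i : (\dim (U i) <= d i)%N.
  by rewrite -dimF dimvS ?subvf.
have dim1 : \dim {:'cV[k]_1} = 1%N by rewrite dimvf /dim /= muln1.
have full1 : fullv != 0%VS :> {vspace 'cV[k]_1} by rewrite -dimv_eq0 dim1.
have slopeU (U : forall i, {vspace framed_of X i}) : nonzero_sub U ->
    (slope Theta (subdim U) < slope Theta d) =
    (theta Theta (subdim U) < slope Theta d * (total_dim (subdim U))%:R).
  case=> i Ui; rewrite theta_slope ?ltr_pM2r ?ltr0n //.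
    by apply: total_dim_gt0; exists i; rewrite /subdim dimv_eq0.
  by apply: total_dim_gt0; exists i; rewrite /subdim dimv_eq0.
rewrite /stable /admissible /semistable /nonzero_rep dimvec_rep_of dimvec_framed_of.
split=> [[_ st] | [_ [_ ss] [i0 fi0] lt_f]].
  (* [U] may be zero here; that case is what yields [f != 0] below. *)
  have theta_lt (U : forall i, {vspace framed_of X i}) :
      is_subrep U -> Defs.proper_sub U ->
      (forall i, (limg (Defs.fmap (framed_of X) i) <= U i)%VS) ->
      theta Theta (subdim U) < slope Theta d * (total_dim (subdim U))%:R.
    move=> sU [i Ui] fU.
    have := st (hat_sub U fullv); rewrite hat_slope_framed //.
    - apply; first exact/subrep_hatT.
        by exists None.
      by exists (Some i).
    - by move=> j; exact: dimU.
    - by exists i; move: Ui; rewrite neq_fullv dimF.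
  split=> //.
  - split=> // U sU [i Ui] pU.
    have := st (hat_sub U 0%VS); rewrite hat_slope_sub //.
    - apply; first exact/subrep_hat0.
        by exists (Some i).
      by exists None; rewrite eq_sym.
    - by move=> j; exact: dimU.
    - by exists i; rewrite /subdim /= dimv_eq0.
    - by rewrite /subdim /= dimv0.
  (* If [f = 0], the zero subrepresentation contains its image and is proper since [d] is nonzero,
     so [theta_lt] gives [0 < 0]. *)
  - apply: contrapT => /forallNP f0.
    have dim0 : subdim (M := framed_of X) (fun=> 0%VS) = fun=> 0%N.
      by apply: funext => i; rewrite /subdim dimv0.
    have := theta_lt (fun=> 0%VS); rewrite dim0 /theta /total_dim.
    rewrite !big1 ?mulr0 ?ltxx // => [|i _]; last by rewrite mulr0.
    move=> absurd; suff : false by []; apply: absurd => [a||i].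
    - by rewrite limg0 sub0v.
    - by case: d_neq0 => i di; exists i; rewrite neq_fullv dimF dimv0 eq_sym.
    have /negP := f0 i; rewrite negbK => /eqP ->.
    by rewrite subv0 limg_eq0.
  - by move=> U sU nU pU fU; rewrite slopeU //; exact: theta_lt.
split; first by exists None.
move=> U sU [v Uv] [w Uw].
pose V i : {vspace framed_of X i} := U (Some i).
(* The space at infinity is a line, so [U None] is either zero or everything. *)
have [U0 | U0] := eqVneq (U None) 0%VS.
  have nV : nonzero_sub V.
    by case: v Uv => [i|]; [exists i | rewrite U0 eqxx].
  rewrite hat_slope_sub //.
  (* [U] may be proper only at infinity; then [V] is all of [M] and the weak inequality is an
     equality. *)
  - have [pV | npV] := pselect (Defs.proper_sub V).
      by apply: ss => //; exact/subrep_hat0.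
    suff -> : (fun i => subdim U (Some i)) = d by [].
    apply: funext => i; rewrite -dimF.
    apply/eqP; apply: contrapT => /negP; rewrite -neq_fullv => Vi.
    by apply: npV; exists i.
  - by move=> i; exact: dimU V i.
  - by case: nV => i Vi; exists i; rewrite dimv_eq0.
  - by rewrite /subdim U0 dimv0.
have UT : U None = fullv.
  by apply/eqP; rewrite eqEdim subvf dim1 lt0n dimv_eq0.
have [sV fV] := (subrep_hatT UT).1 sU.
case: w Uw => [i Ui|]; last by rewrite UT eqxx.
(* [V] contains the image of the nonzero [f]. *)
have nV : nonzero_sub V.
  exists i0; apply: contraNneq fi0 => Vi0.
  by have := fV i0; rewrite -/(V i0) Vi0 subv0 limg_eq0.
rewrite hat_slope_framed //.
- by rewrite -slopeU //; apply: lt_f => //; exists i.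
- by move=> j; exact: dimU V j.
- by exists i; move: Ui; rewrite neq_fullv dimF.
- by rewrite /subdim UT.
Qed.

(** * Matrix representatives of framed representations *)

Lemma coordinate_iso (k : fieldType) (V : vectType k) (m : nat) : \dim {:V} = m ->
  exists phi : 'Hom(V, 'cV[k]_m), bijective phi.
Proof.
(* The coordinates [v2r] are row vectors, whereas [rep_of] uses columns; hence the transpose. *)
move=> <-; pose g (u : 'cV[k]_(dim V)) : V := r2v u^T.
rewrite dimvf; exists (linfun (trmx \o v2r)); exists g => x.
  by rewrite lfunE /g /= trmxK v2rK.
by rewrite lfunE /g /= r2vK trmxK.
Qed.

Lemma framed_of_surj (k : fieldType) (Q : quiver) (d n : vertex Q -> nat)
    (p : framed k n) : dimvec p =1 d ->
  exists X : rep_space k (@hatd Q n d), framed_equiv p (framed_of X).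
Proof.
move=> dimp; pose phi i := sval (cid (coordinate_iso (dimp i))).
have bij_phi i : bijective (phi i) := svalP (cid (coordinate_iso (dimp i))).
have phiK i := (bij_lfunK (bij_phi i)).1.
(* The structure is transported along the chosen bases; the [j]-th arrow from infinity to [i]
   receives the image under [f_i] of the [j]-th basis vector. *)
pose X : rep_space k (@hatd Q n d) := fun a => match a with
  | inl a => mx_of (phi (tgt a) \o amap p a \o (phi (src a))^-1)%VF
  | inr t => phi (tag t) (Defs.fmap p (tag t) (delta_mx (tagged t) 0)) end.
exists X; exists phi; split=> [|i].
  split=> // a; apply/lfunP => x; rewrite !comp_lfunE /= linfun_mulmxE mul_mx_of.
  by rewrite !comp_lfunE /= phiK.
rewrite -[RHS]mx_ofK /= -/(framing_mx _ _); congr (linfun (mulmx _)).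
apply/matrixP => l j; rewrite mxE [RHS]mxE comp_lfunE; congr (_ l 0).
Qed.

(** * The bijection on points of the quotient *)

Lemma bijection_cid (T U : Type) (f : T -> U) :
  injective f -> (forall u, exists t, f t = u) -> bijective f.
Proof.
move=> inj_f surj_f; pose g u := sval (cid (surj_f u)).
have gK : cancel g f by move=> u; exact: svalP (cid (surj_f u)).
by exists g => // t; apply: inj_f; rewrite gK.
Qed.

Theorem lemma3p5 (R : realType) (Q : quiver) (Theta : vertex Q -> rat)
    (d n : vertex Q -> nat)
    (d_neq0 : exists i, d i != 0%N) (n_neq0 : exists i, n i != 0%N) :
  exists2 eps0 : rat, 0 < eps0 &
    forall eps : rat, 0 < eps -> eps < eps0 ->
    forall (Y : fspace R[i]) (pi : smooth_model_locus R[i] Theta d n eps -> Y),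
    is_smooth_model R[i] Theta d n eps Y pi ->
    exists Psi : Y -> framed_classes R[i] n Theta d,
      bijective Psi /\
      forall X : smooth_model_locus R[i] Theta d n eps,
        sval (Psi (pi X)) = framed_class Theta d (framed_of (sval X)).
Proof.
have [eps0 eps0_gt0 small] := small_epsP Theta d.
exists eps0 => // eps eps_gt0 eps_lt Y pi [pi_surj pi_fibre _ _].
have stP := stable_framedP _ d_neq0 (small _ eps_gt0 eps_lt).
(* A representative is chosen in each fibre of [pi]; as fibres are orbits, its class does not depend
   on the choice. *)
pose x y := sval (cid (pi_surj y)).
have xK : cancel x pi by move=> y; exact: svalP (cid (pi_surj y)).
have adm (X : smooth_model_locus R[i] Theta d n eps) :
    admissible Theta d (framed_of (sval X)) by apply/stP; exact: svalP X.
pose Psi y : framed_classes R[i] n Theta d :=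
  exist _ (framed_class Theta d (framed_of (sval (x y))))
    (ex_intro _ (framed_of (sval (x y))) (conj (adm (x y)) erefl)).
have PsiE X : sval (Psi (pi X)) = framed_class Theta d (framed_of (sval X)).
  by apply/framed_class_eq/framed_equiv_orbit; apply/pi_fibre; rewrite xK.
exists Psi; split=> //; apply: bijection_cid => [y y' | [C [p [adm_p CE]]]].
  move=> /(congr1 sval) /= eqyy'; rewrite -[y]xK -[y']xK; apply/pi_fibre/framed_equiv_orbit.
  exact: framed_class_inj eqyy'.
(* For surjectivity, an admissible pair is replaced by an equivalent matrix point, which is again
   admissible and therefore stable. *)
have [X pX] : exists X : rep_space R[i] (@hatd Q n d), framed_equiv p (framed_of X).
  by apply: framed_of_surj; case: adm_p.
have stX : stable (hatTheta Theta d eps) (rep_of X).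
  by apply/stP; exact: admissible_equiv adm_p.
exists (pi (exist _ X stX)); apply: eq_exist.
by rewrite [LHS]PsiE CE; apply/esym/framed_class_eq.
Qed.
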